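(* Let $(X,|\cdot|)$ be a (real) Hilbert space with inner product $\langle\cdot,\cdot\rangle$ and let $\omega$ be a modulus of continuity that is increasing and satisfies $\lim_{t\to\infty}\omega(t)=\infty$. Let $\emptyset\ne E\subset X$ and let $f:E\to\mathbb{R}$, $G:E\to X$ be arbitrary functions. (i) There exists a convex function $F\in C^{1,\omega}(X)$ with $F=f$ and $\nabla F=G$ on $E$ if and only if there is some $M>0$ such that $$f(y)\ge f(z)+\langle G(z),y-z\rangle+M(\varphi_\omega)^*\!\left(\tfrac1M|G(y)-G(z)|\right)\quad\text{for all }y,z\in E. \quad ( * )$$ (ii) If $( * )$ holds with constant $M>0$, then the formula $$F:=\operatorname{conv}(g),\qquad g(x)=\inf_{y\in E}\{f(y)+\langle G(y),x-y\rangle+M\varphi_\omega(|x-y|)\},\quad x\in X,$$ defines such an extension ($F\in C^{1,\omega}(X)$ convex, $(F,\nabla F)=(f,G)$ on $E$), and $$A_{\omega,\mathrm{co}}(F,\nabla F,X)\le 2M\quad\text{and}\quad\operatorname{Lip}_\omega(\nabla F,X)\le\tfrac83 M.$$ (iii) If, in addition to $( * )$ with constant $M>0$, $G$ is bounded and $L:=\sup_{z\in E}|G(z)|$, then $F_L:=\operatorname{conv}_L(g)$, with the same $g$ as in (ii), has the same properties as $F$ (convex, in $C^{1,\omega}(X)$, $(F_L,\nabla F_L)=(f,G)$ on $E$, and both estimates in (ii) hold for $F_L$), and moreover $F_L$ is Lipschitz on $X$ with $$\sup_{x\in X}|\nabla F_L(x)|=\operatorname{Lip}(F_L,X)=L=\sup_{z\in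 E}|G(z)|.$$
   Context: A modulus of continuity is a non-decreasing concave function $\omega:[0,\infty)\to[0,\infty)$ with $\omega(0)=\omega(0^+)=0$. Put $\varphi_\omega(t)=\int_0^t\omega(s)\,ds$ for $t\ge0$; its Fenchel conjugate is $(\varphi_\omega)^*(t)=\sup_{s\ge0}\{ts-\varphi_\omega(s)\}$ for $t\ge0$. The dual $X^*$ is identified with $X$, and $\nabla F(x)\in X$ represents the Fréchet derivative $DF(x)$. For $E\subset X$ and a map $H$ from $E$ to a normed space $Y$, $\operatorname{Lip}_\omega(H,E)=\sup_{x\ne z\in E}\frac{\|H(x)-H(z)\|_Y}{\omega(|x-z|)}$, and $\operatorname{Lip}(H,E)$ is the case $\omega(t)=t$. $C^{1,\omega}(X)$ is the class of everywhere Fréchet differentiable $F:X\to\mathbb{R}$ with continuous $\nabla F$ and $\operatorname{Lip}_\omega(\nabla F,X)<\infty$. For $f:E\to\mathbb{R}$, $G:E\to X$, $$A_{\omega,\mathrm{co}}(f,G,E)=\sup\left\{\frac{f(z)+\langle G(z),x-z\rangle-f(y)-\langle G(y),x-y\rangle}{\varphi_\omega(|x-y|)}: y,z\in E,\ x\in X,\ x\neq y\right\}\in[0,+\infty].$$ Suprema over the empty set are $0$ in these definitions. For $g:X\to\mathbb{R}$ with a continuous affine minorant, $\operatorname{conv}(g)(x)=\sup\{h(x): h:X\to\mathbb{R}\text{ convex and continuous},\ h\le g\text{ on }X\}$. For $L\ge0$ and $g$ with an $L$-Lipschitz affine minorant, $\operatorname{conv}_L(g)(x)=\sup\{h(x):h:X\to\mathbb{R}\text{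 convex and }L\text{-Lipschitz},\ h\le g\text{ on }X\}$. *)

(* Defs.v *)
From HB Require Import structures.
From mathcomp Require Import all_boot all_order all_algebra.
From mathcomp Require Import all_classical all_reals all_analysis.

Set Implicit Arguments.
Unset Strict Implicit.
Unset Printing Implicit Defensive.

Import Order.TTheory GRing.Theory Num.Theory.
Import numFieldNormedType.Exports.

Local Open Scope classical_set_scope.
Local Open Scope ring_scope.

(* A real Hilbert space is a complete normed module [X] together with an inner
   product [dot] satisfying [norm_from dot]. A function with domain [E : set X],
   or with domain [0, +oo[, is a total function whose values outside that domain
   are never used. *)

Definition norm_from (R : realType) (X : normedModType R)
    (dot : {dot X for idfun}) : Prop :=
  forall x : X, `|x| ^+ 2 = dot x x.

Definition modulus_of_continuity (R : realType) (omega : R -> R) : Prop :=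
  [/\ {in `[0, +oo[, forall t, 0 <= omega t},
      {in `[0, +oo[ &, {homo omega : s t / s <= t}},
      @convex_function R R^o `[0, +oo[%classic (fun t => - omega t),
      omega 0 = 0
    & omega t @[t --> 0^'+] --> 0].

Definition phi (R : realType) (omega : R -> R) (t : R) : R :=
  (\int[lebesgue_measure]_(s in `[0, t]) omega s)%R.

(* The supremum is finite for [psi = phi omega] when [omega] tends to +oo. *)
Definition fenchel_conj (R : realType) (psi : R -> R) (t : R) : R :=
  sup [set t * s - psi s | s in `[0, +oo[].

Section lipschitz_constants.
Context {R : realType} {X : normedModType R}.
Local Open Scope ereal_scope.

(* [supremum 0 S] is the supremum of [S], with value 0 when [S] is empty. *)
Definition lip_omega (Y : normedModType R) (omega : R -> R) (H : X -> Y)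
    (E : set X) : \bar R :=
  supremum 0 [set r | exists x z, [/\ E x, E z, x <> z &
    r = (`|H x - H z| / omega `|x - z|)%R%:E]].

Definition lip (Y : normedModType R) (H : X -> Y) (E : set X) : \bar R :=
  lip_omega id H E.

Definition A_co (dot : {dot X for idfun}) (omega : R -> R) (f : X -> R)
    (G : X -> X) (E : set X) : \bar R :=
  supremum 0 [set r | exists y z x, [/\ E y, E z, x <> y &
    r = ((f z + dot (G z) (x - z) - f y - dot (G y) (x - y))
          / phi omega `|x - y|)%R%:E]].

End lipschitz_constants.

Section gradient.
Context {R : realType} {X : normedModType R}.
Variable dot : {dot X for idfun}.

(* The Riesz representative of the differential of [F] at [x]. *)
Definition grad (F : X -> R) (x : X) : X :=
  get [set v | forall h, 'd F x h = dot v h].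

Definition C1_omega (omega : R -> R) (F : X -> R) : Prop :=
  [/\ forall x, differentiable F x,
      continuous (grad F)
    & (lip_omega omega (grad F) setT < +oo)%E].

Definition extends_jet (E : set X) (f : X -> R) (G : X -> X) (F : X -> R)
    : Prop :=
  forall y, E y -> F y = f y /\ grad F y = G y.

Definition cond_star (omega : R -> R) (E : set X) (f : X -> R) (G : X -> X)
    (M : R) : Prop :=
  forall y z, E y -> E z ->
    f y >= f z + dot (G z) (y - z)
           + M * fenchel_conj (phi omega) (M^-1 * `|G y - G z|).

Definition upper_values (omega : R -> R) (E : set X) (f : X -> R) (G : X -> X)
    (M : R) (x : X) : set R :=
  [set f y + dot (G y) (x - y) + M * phi omega `|x - y| | y in E].

Definition upper_env (omega : R -> R) (E : set X) (f : X -> R) (G : X -> X)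
    (M : R) (x : X) : R :=
  inf (upper_values omega E f G M x).

End gradient.

Section convex_envelopes.
Context {R : realType} {X : normedModType R}.

Definition has_continuous_affine_minorant (g : X -> R) : Prop :=
  exists (l : {scalar X}) (c : R),
    continuous (l : X -> R) /\ forall x, l x + c <= g x.

Definition has_lipschitz_affine_minorant (L : R) (g : X -> R) : Prop :=
  exists (l : {scalar X}) (c : R),
    L.-lipschitz (fun x => l x + c : R) /\ forall x, l x + c <= g x.

(* [conv_env g] is meaningful when [has_continuous_affine_minorant g], and
   [conv_env_lip L g] when [has_lipschitz_affine_minorant L g]: the sets below are
   then nonempty, and [g x] bounds them. *)
Definition conv_env (g : X -> R) (x : X) : R :=
  sup [set h x | h in [set h : X -> R |
    [/\ convex_function setT h, continuous h & forall z, h z <= g z]]].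

Definition conv_env_lip (L : R) (g : X -> R) (x : X) : R :=
  sup [set h x | h in [set h : X -> R |
    [/\ convex_function setT h, L.-lipschitz h & forall z, h z <= g z]]].

End convex_envelopes.

(* Main.v *)
Require Import Defs.
From HB Require Import structures.
From mathcomp Require Import all_boot all_order all_algebra.
From mathcomp Require Import all_classical all_reals all_analysis.
From mathcomp Require Import measurable_realfun.
From mathcomp Require Import ring lra.

Set Implicit Arguments.
Unset Strict Implicit.
Unset Printing Implicit Defensive.

Import Order.TTheory GRing.Theory Num.Theory.
Import numFieldNormedType.Exports.

Local Open Scope classical_set_scope.
Local Open Scope ring_scope.

(* Let Phi := phi omega. Since omega s / s is nonincreasing, r |-> Phi (sqrt r) is
   concave, and the parallelogram law gives
     Phi |v + h| + Phi |v - h| <= 2 Phi |v| + 2 Phi |h|.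
   Hence g (x + h) + g (x - h) <= 2 g x + 2 M Phi |h|. If h1 and h2 are convex
   minorants of g, so is x |-> (h1 (x + a) + h2 (x - a) - 2 M Phi |a|) / 2;
   therefore the envelope F inherits the inequality, and being convex it is
   differentiable with 0 <= F (x + h) - F x - <grad F x, h> <= 2 M Phi |h|.
   By Young's inequality the condition (star) says that every tangent
   f z + <G z, . - z> lies below g, so F = f and grad F = G on E.
   Comparing the expansions at x and z in the direction of
   D := grad F x - grad F z at distance s gives
     |D| (2 s - |x - z|) <= 4 M Phi s,
   and s = 2 |x - z| together with Phi (2 d) <= 2 d omega d yields the constant
   8/3. Conversely, the first-order conditions of a convex C^{1,omega} function
   and t omega t <= 2 Phi t give the same kind of expansion, hence (star). *)

(* Telescoping over [N] equal steps bounds the increment of [H] by [(b - a) / N]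
   times that of [W]. *)
Lemma le_of_quadratic_increments (R : realType) (H W : R -> R) (a b : R) :
  a <= b ->
  (forall s t, a <= s -> s <= t -> t <= b ->
     H t - H s <= (t - s) * (W t - W s)) ->
  H b <= H a.
Proof.
move=> ab HW.
have step (N : nat) : (0 < N)%N -> N%:R * (H b - H a) <= (b - a) * (W b - W a).
  move=> N0; pose x (k : nat) := a + k%:R * ((b - a) / N%:R).
  have NR : N%:R != 0 :> R by rewrite pnatr_eq0 -lt0n.
  have d0 : 0 <= (b - a) / N%:R by rewrite divr_ge0 ?subr_ge0.
  have xN : x N = b by rewrite /x mulrCA divff// mulr1 addrC subrK.
  have tel (k : nat) : (k <= N)%N ->
      H (x k) - H a <= (b - a) / N%:R * (W (x k) - W a).
    elim: k => [|k IH] kN; first by rewrite /x mul0r addr0 !subrr mulr0.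
    have xS : x k.+1 - x k = (b - a) / N%:R.
      by rewrite /x -addn1 natrD; ring.
    have := HW (x k) (x k.+1).
    rewrite xS => /(_ _ _ _)/wrap[|||].
    - by rewrite lerDl mulr_ge0.
    - by rewrite -subr_ge0 xS.
    - by rewrite -xN lerD2l ler_wpM2r// ler_nat.
    by have := IH (ltnW kN); lra.
  have := tel _ (leqnn N); rewrite xN => h.
  rewrite -ler_pdivlMl ?ltr0n//; apply: le_trans h _.
  by rewrite mulrAC [leRHS]mulrC mulrAC.
rewrite -subr_le0 leNgt; apply/negP => d0.
set C := (b - a) * (W b - W a) in step.
have [N /andP[N0 hN]] : exists N, (0 < N)%N && (C < N%:R * (H b - H a)).
  exists (Num.truncn `|C / (H b - H a)|).+1; rewrite /= -ltr_pdivrMr//.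
  by rewrite (le_lt_trans (ler_norm _))// truncnS_gt.
by have := step _ N0; rewrite leNgt hN.
Qed.

(** * Moduli of continuity and the growth of their primitive [phi omega] *)

Section modulus.
Context {R : realType} (omega : R -> R).
Context (om_mod : modulus_of_continuity omega).

Lemma modulus_ge0 t : 0 <= t -> 0 <= omega t.
Proof. by move=> t0; case: om_mod => + _ _ _ _; apply; rewrite in_itv/= t0. Qed.

Lemma modulus0 : omega 0 = 0.
Proof. by case: om_mod. Qed.

Lemma modulus_le s t : 0 <= s -> s <= t -> omega s <= omega t.
Proof.
move=> s0 st; case: om_mod => _ + _ _ _; apply => //; rewrite in_itv/= ?s0//.
by rewrite (le_trans s0 st).
Qed.

Lemma modulus_concave (t x y : R) : 0 <= t -> t <= 1 -> 0 <= x -> 0 <= y ->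
  t * omega x + (1 - t) * omega y <= omega (t * x + (1 - t) * y).
Proof.
move=> t0 t1 x0 y0; case: om_mod => _ _ + _ _.
have tI : Itv.spec (@Itv.num_sem R) (Itv.Real `[0%Z, 1%Z]) t.
  by rewrite /= /Itv.num_sem /= num_real /= in_itv/= t0 t1.
move=> /(_ (Itv.mk tI) x y); rewrite !inE/= !in_itv/= x0 y0.
move=> /(_ isT isT) h.
have {h} : - (omega (t * x + (1 - t) * y)) <=
   t * - omega x + (1 - t) * - omega y by exact: h.
by lra.
Qed.

(** Concavity on the segment from [0] to [b], together with [omega 0 = 0]. This is the monotonicity
    of [omega s / s], cleared of denominators so that [a = 0] is allowed. *)
Lemma modulus_slope a b : 0 <= a -> a <= b -> a * omega b <= b * omega a.
Proof.
move=> a0 ab; have [b0|b0] := eqVneq b 0.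
  have a00 : a = 0 by apply: le_anti; rewrite a0 -b0 ab.
  by rewrite a00 b0 !mul0r.
have bp : 0 < b by rewrite lt_neqAle eq_sym b0 (le_trans a0 ab).
have := @modulus_concave (a / b) b 0 _ _ (ltW bp) (lexx _).
rewrite modulus0 !mulr0 !addr0 divfK// => /(_ _ _)/wrap[||h].
- by rewrite divr_ge0// ltW.
- by rewrite ler_pdivrMr// mul1r.
by rewrite -ler_pdivrMl// mulrA [_^-1 * _]mulrC.
Qed.

Lemma modulus_midpoint a d : 0 <= a -> a <= d ->
  omega (d + a) + omega (d - a) <= 2 * omega d.
Proof.
move=> a0 ad; have := @modulus_concave (1/2) (d + a) (d - a).
have -> : 1 / 2 * (d + a) + (1 - 1 / 2) * (d - a) = d by field.
by move=> /(_ _ _ _ _)/wrap[||||]; lra.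
Qed.

Lemma modulus_integrable (b : R) :
  lebesgue_measure.-integrable `[0, b] (EFin \o omega).
Proof.
(* [omega] is monotone only on the half line; freezing it at [omega 0] to the left gives a function
   monotone on all of [R], hence measurable. *)
pose om (s : R) : R := omega (Num.max s 0).
apply: (@eq_integrable _ _ R lebesgue_measure _ (measurable_itv `[0, b])
  (EFin \o om) (EFin \o omega)).
  move=> s; rewrite inE/= in_itv/= => /andP[s0 _].
  by rewrite /om /= max_l.
apply: measurable_bounded_integrable => //.
- have : (lebesgue_measure (`[0%R, b]%classic : set R) < +oo)%E.
    by rewrite lebesgue_measure_itv/=; case: ifP => // _; rewrite -EFinB ltry.
  exact.
- apply: nondecreasing_measurable => // s t st.
  apply: modulus_le; first by rewrite le_max lexx orbT.
  by rewrite ge_max !le_max lexx st orbT.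
- exists (omega (Num.max b 0)); split; first exact: num_real.
  move=> x bx s /=; rewrite in_itv/= => /andP[s0 sb].
  rewrite /om max_l// ger0_norm ?modulus_ge0//.
  by rewrite (le_trans _ (ltW bx))// modulus_le// le_max sb.
Qed.

Lemma phi0 : phi omega 0 = 0.
Proof. by rewrite /phi set_itv1 Rintegral_set1. Qed.

(** Monotonicity bounds the integrand by its end values. The later estimates on [phi] rest on this
    one, so [phi] is never differentiated. *)
Lemma phi_increment (a b : R) : 0 <= a -> a <= b ->
  omega a * (b - a) <= phi omega b - phi omega a <= omega b * (b - a).
Proof.
move=> a0 ab.
have -> : phi omega b - phi omega a =
    (\int[lebesgue_measure]_(s in `]a, b]) omega s)%R.
  by apply: Rintegral_itvB; rewrite ?bnd_simp//; exact: modulus_integrable.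
have ioab : lebesgue_measure.-integrable `]a, b] (EFin \o omega).
  apply: integrableS (modulus_integrable b) => //.
  by apply: subset_itvr; rewrite bnd_simp.
have lab : lebesgue_measure (`]a, b]%classic : set R) = (b - a)%:E.
  rewrite lebesgue_measure_itv/= lte_fin; case: ltP => [//|ba].
  by rewrite (@le_anti _ _ a b) ?ab// subrr.
have icst c : lebesgue_measure.-integrable `]a, b] (EFin \o cst c).
  have ltab : (lebesgue_measure (`]a, b]%classic : set R) < +oo)%E.
    by rewrite lab ltry.
  apply: measurable_bounded_integrable  => //.
  exists `|c|; split; first exact: num_real.
  by move=> x cx s _ /=; exact: ltW.
have Icst c : (\int[lebesgue_measure]_(s in `]a, b]) cst c s)%R = c * (b - a).
  by rewrite Rintegral_cst//; congr (_ * _); exact: (congr1 fine lab).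
by apply/andP; split; rewrite -Icst; apply: le_Rintegral => // s /=;
  rewrite in_itv/= => /andP[/ltW as_ sb]; apply: modulus_le => //;
  apply: le_trans as_.
Qed.

Lemma phi_le a b : 0 <= a -> a <= b -> phi omega a <= phi omega b.
Proof.
move=> a0 ab; have /andP[h _] := phi_increment a0 ab.
by rewrite -subr_ge0; apply: le_trans h; rewrite mulr_ge0 ?modulus_ge0 ?subr_ge0.
Qed.

Lemma phi_ge0 t : 0 <= t -> 0 <= phi omega t.
Proof. by rewrite -[X in _ -> X <= _]phi0; exact: phi_le. Qed.

Lemma phi_le_mul t : 0 <= t -> phi omega t <= t * omega t.
Proof.
by move=> t0; have := phi_increment (lexx 0) t0; rewrite phi0; lra.
Qed.

Lemma phi_double_le d : 0 <= d -> phi omega (2 * d) <= 2 * d * omega d.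
Proof.
move=> d0.
(* Formally [H] has derivative [omega (d + r) + omega (d - r) - 2 * omega d], which is nonpositive
   by [modulus_midpoint]; the comparison of [H d] with [H 0] is the claim. *)
pose H r := phi omega (d + r) - phi omega (d - r) - 2 * omega d * r.
have := @le_of_quadratic_increments _ H (fun r => omega (d + r)) 0 d d0.
rewrite /H addr0 subr0 !subrr phi0 => /(_ _)/wrap[s t s0 st td|]; last first.
  have -> : d + d = 2 * d by ring.
  by lra.
have := @phi_increment (d + s) (d + t).
have := @phi_increment (d - t) (d - s).
move=> /(_ _ _)/wrap[||/andP[_ h1]]; [lra|lra|].
move=> /(_ _ _)/wrap[||/andP[_ h2]]; [lra|lra|].
have h3 := @modulus_midpoint s d s0 (le_trans st td).
have : 0 <= (t - s) * (2 * omega d - omega (d + s) - omega (d - s)).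
  by rewrite mulr_ge0; lra.
by lra.
Qed.

(* The tangent line at [c ^+ 2] of the concave function [r |-> phi (sqrt r)]. *)
Lemma phi_sqrt_tangent c r : 0 < c -> 0 <= r ->
  phi omega r <= phi omega c + omega c / c / 2 * (r ^+ 2 - c ^+ 2).
Proof.
move=> c0 r0; set k := omega c / c.
have ck : omega c = k * c by rewrite /k divfK// gt_eqF.
(* The line [k * s] meets [omega s] at [s = c]. By [modulus_slope], [omega] lies below it to the
   right of [c] and above it to the left, so each case integrates an inequality of constant sign. *)
have [cr|/ltW rc] := leP c r.
- pose H s := phi omega s - k / 2 * s ^+ 2.
  have := @le_of_quadratic_increments _ H (fun s => k / 2 * s) c r cr.
  rewrite /H => /(_ _)/wrap[s t s0 st td|]; last by lra.
  have cs : 0 <= s by lra.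
  have /andP[_ h] := phi_increment cs st.
  have : omega t <= k * t.
    have := @modulus_slope c t (ltW c0); rewrite ck => /(_ _)/wrap[|]; first lra.
    by rewrite -[in X in _ -> X](ler_pM2l c0); lra.
  move=> h2; have : (t - s) * (omega t) <= (t - s) * (k * t).
    by rewrite ler_wpM2l// subr_ge0.
  by nra.
- pose H s := k / 2 * s ^+ 2 - phi omega s.
  have := @le_of_quadratic_increments _ H (fun s => k / 2 * s) r c rc.
  rewrite /H => /(_ _)/wrap[s t s0 st td|]; last by lra.
  have cs : 0 <= s by lra.
  have /andP[h _] := phi_increment cs st.
  have : k * s <= omega s.
    have := @modulus_slope s c cs; rewrite ck => /(_ _)/wrap[|]; first lra.
    by rewrite -[in X in _ -> X](ler_pM2l c0); lra.
  move=> h2; have : (t - s) * (k * s) <= (t - s) * omega s.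
    by rewrite ler_wpM2l// subr_ge0.
  by nra.
Qed.

(** The tangent at [t ^+ 2], evaluated at [0], where [phi] vanishes. Linear [omega] gives
    equality. *)
Lemma mul_modulus_le_phi t : 0 <= t -> t * omega t <= 2 * phi omega t.
Proof.
rewrite le_eqVlt => /predU1P[<-|t0]; first by rewrite phi0 mul0r mulr0.
have := phi_sqrt_tangent t0 (lexx 0); rewrite phi0.
have -> : omega t / t / 2 * (0 ^+ 2 - t ^+ 2) = - (t * omega t) / 2.
  by field; rewrite gt_eqF.
by lra.
Qed.

(** As a function of [r ^+ 2], [phi] is concave and vanishes at [0], so its slopes from the origin
    decrease. *)
Lemma phi_div_sqr_nonincreasing u w : 0 <= u -> u <= w ->
  u ^+ 2 * phi omega w <= w ^+ 2 * phi omega u.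
Proof.
rewrite le_eqVlt => /predU1P[<- _|u0 uw]; first by rewrite phi0 expr0n mul0r mulr0.
have w0 : 0 <= w by rewrite (le_trans (ltW u0)).
have h1 := phi_sqrt_tangent u0 w0; have h2 := mul_modulus_le_phi (ltW u0).
have u20 : 0 < u ^+ 2 by rewrite exprn_gt0.
have : u ^+ 2 * phi omega w <=
    u ^+ 2 * (phi omega u + omega u / u / 2 * (w ^+ 2 - u ^+ 2)).
  by rewrite ler_pM2l.
have -> : u ^+ 2 * (phi omega u + omega u / u / 2 * (w ^+ 2 - u ^+ 2)) =
    u ^+ 2 * phi omega u + u * omega u / 2 * (w ^+ 2 - u ^+ 2).
  by field; rewrite gt_eqF.
have : 0 <= (2 * phi omega u - u * omega u) * (w ^+ 2 - u ^+ 2).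
  by rewrite mulr_ge0 ?subr_ge0// ler_pXn2r ?nnegrE// ltW.
by lra.
Qed.

(** Jensen's inequality followed by subadditivity for the concave [r |-> phi (sqrt r)]: [w ^+ 2] is
    the mean of [a ^+ 2] and [b ^+ 2], and also the sum of [v ^+ 2] and [h ^+ 2]. *)
Lemma phi_parallelogram a b v h : 0 <= a -> 0 <= b -> 0 <= v -> 0 <= h ->
  a ^+ 2 + b ^+ 2 = 2 * (v ^+ 2 + h ^+ 2) ->
  phi omega a + phi omega b <= 2 * phi omega v + 2 * phi omega h.
Proof.
move=> a0 b0 v0 h0 par.
have [w0|w0] := eqVneq (v ^+ 2 + h ^+ 2) 0.
  have /andP[/eqP a00 /eqP b00] : (a == 0) && (b == 0).
    by rewrite -!(sqrf_eq0 a) -!(sqrf_eq0 b) -paddr_eq0 ?sqr_ge0// par w0 mulr0.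
  by rewrite a00 b00 phi0 !addr0 addr_ge0// mulr_ge0// phi_ge0.
pose w := Num.sqrt (v ^+ 2 + h ^+ 2).
have vh0 : 0 <= v ^+ 2 + h ^+ 2 by rewrite addr_ge0 ?sqr_ge0.
have w2 : w ^+ 2 = v ^+ 2 + h ^+ 2 by rewrite sqr_sqrtr.
have wp : 0 < w by rewrite sqrtr_gt0 lt_neqAle eq_sym w0.
have ha := phi_sqrt_tangent wp a0; have hb := phi_sqrt_tangent wp b0.
have wle u : 0 <= u -> u ^+ 2 <= v ^+ 2 + h ^+ 2 ->
    u ^+ 2 * phi omega w <= w ^+ 2 * phi omega u.
  move=> u0 uw; apply: phi_div_sqr_nonincreasing => //.
  by rewrite -(ler_pXn2r (n := 2)) ?nnegrE// ?w2// ltW.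
have h1 : v ^+ 2 * phi omega w <= w ^+ 2 * phi omega v.
  by apply: wle; rewrite // lerDl sqr_ge0.
have h2 : h ^+ 2 * phi omega w <= w ^+ 2 * phi omega h.
  by apply: wle; rewrite // lerDr sqr_ge0.
have h3 : phi omega w <= phi omega v + phi omega h.
  rewrite -(ler_pM2l (exprn_gt0 2%N wp)) {1}w2; lra.
set k := omega w / w / 2 in ha hb.
have : k * (a ^+ 2 - w ^+ 2) + k * (b ^+ 2 - w ^+ 2) = 0.
  by rewrite -mulrDr addrACA par w2; ring.
by lra.
Qed.

End modulus.

(** * Convexity with real weights, and continuity of Lipschitz maps *)

Lemma convex_functionP (R : realType) (V : lmodType R) (F : V -> R) :
  convex_function setT F <->
  forall t x y, 0 <= t -> t <= 1 ->
    F (t *: x + (1 - t) *: y) <= t * F x + (1 - t) * F y.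
Proof.
split=> [cF t x y t0 t1|cF t x y _ _]; last first.
  by apply: cF; [exact: ge0|exact: le1].
have tI : Itv.spec (@Itv.num_sem R) (Itv.Real `[0%Z, 1%Z]) t.
  by rewrite /= /Itv.num_sem /= num_real /= in_itv/= t0 t1.
by have := cF (Itv.mk tI) x y; rewrite !inE => /(_ Logic.I Logic.I).
Qed.

Lemma continuous_of_lipschitz (R : realType) (V W : normedModType R)
    (F : V -> W) (C : R) :
  (forall x y, `|F x - F y| <= C * `|x - y|) -> continuous F.
Proof.
move=> FC x; apply/cvgrPdist_lt => e e0; near=> y.
apply: le_lt_trans (FC x y) _.
apply: (@le_lt_trans _ _ (`|C| * `|x - y|)); first by rewrite ler_wpM2r// ler_norm.
apply: (@le_lt_trans _ _ ((`|C| + 1) * `|x - y|)).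
  by rewrite ler_wpM2r// lerDl.
have C0 : 0 < `|C| + 1 by rewrite ltr_wpDl.
rewrite mulrC -ltr_pdivlMr//; near: y.
by apply: cvgr_dist_lt; rewrite ?divr_gt0.
Unshelve. all: by end_near. Qed.

(** * Inner product identities and Riesz representation *)

Section inner_product.
Context {R : realType} {X : normedModType R} (dot : {dot X for idfun}).
Context (hilbert : norm_from dot).
Implicit Types x y z u v h : X.

Lemma dotC x y : dot x y = dot y x.
Proof. by have := @hermitian_subproof _ _ _ _ dot x y; rewrite mul1r. Qed.

Lemma dotDr x y z : dot x (y + z) = dot x y + dot x z.
Proof. exact: raddfD. Qed.

Lemma dotNr x y : dot x (- y) = - dot x y.
Proof. exact: raddfN. Qed.

Lemma dotBr x y z : dot x (y - z) = dot x y - dot x z.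
Proof. by rewrite dotDr dotNr. Qed.

Lemma dotZr a x y : dot x (a *: y) = a * dot x y.
Proof. exact: linearZ. Qed.

Lemma dotDl x y z : dot (x + y) z = dot x z + dot y z.
Proof. by rewrite ![dot _ z]dotC dotDr. Qed.

Lemma dotBl x y z : dot (x - y) z = dot x z - dot y z.
Proof. by rewrite ![dot _ z]dotC dotBr. Qed.

Lemma dotZl a x y : dot (a *: x) y = a * dot x y.
Proof. by rewrite ![dot _ y]dotC dotZr. Qed.

Lemma dot0r x : dot x 0 = 0.
Proof. exact: raddf0. Qed.

Lemma dot0l x : dot 0 x = 0.
Proof. by rewrite dotC dot0r. Qed.

Lemma normD_sqr x y : `|x + y| ^+ 2 = `|x| ^+ 2 + 2 * dot x y + `|y| ^+ 2.
Proof. by rewrite !hilbert !dotDl !dotDr (dotC y x); ring. Qed.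

Lemma normB_sqr x y : `|x - y| ^+ 2 = `|x| ^+ 2 - 2 * dot x y + `|y| ^+ 2.
Proof. by rewrite normD_sqr normrN dotNr; ring. Qed.

Lemma parallelogram x y :
  `|x + y| ^+ 2 + `|x - y| ^+ 2 = 2 * (`|x| ^+ 2 + `|y| ^+ 2).
Proof. by rewrite normD_sqr normB_sqr; ring. Qed.

Lemma dot_le_norm x y : dot x y <= `|x| * `|y|.
Proof.
have [->|x0] := eqVneq x 0; first by rewrite dot0l normr0 mul0r.
have [->|y0] := eqVneq y 0; first by rewrite dot0r normr0 mulr0.
have xy0 : 0 < `|x| * `|y| by rewrite mulr_gt0 ?normr_gt0.
(* This square equals [2 * |x| * |y| * (|x| * |y| - dot x y)]. *)
have := sqr_ge0 `| `|y| *: x - `|x| *: y|.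
rewrite normB_sqr !normrZ !normr_id dotZl dotZr => h.
rewrite -(ler_pM2l xy0); nra.
Qed.

Lemma normr_dot_le x y : `|dot x y| <= `|x| * `|y|.
Proof.
by rewrite ler_norml dot_le_norm andbT lerNl -dotNr -(normrN y) dot_le_norm.
Qed.

Lemma dot_injective u v : (forall h, dot u h = dot v h) -> u = v.
Proof.
move=> uv; apply/subr0_eq/eqP; rewrite -normr_eq0 -sqrf_eq0 hilbert.
by rewrite dotBl uv subrr.
Qed.

Lemma dot_continuous u : continuous (dot u : X -> R).
Proof.
apply: (@continuous_of_lipschitz _ _ _ _ `|u|) => x y.
by rewrite -dotBr normr_dot_le.
Qed.

End inner_product.

(** Direct method: a minimising sequence of [J v = |v| ^+ 2 - 2 * l v] is Cauchy by the
    parallelogram law, and stationarity of [J] at its limit reads [l h = dot v h]. *)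
Lemma riesz (R : realType) (X : completeNormedModType R)
    (dot : {dot X for idfun}) (l : {linear X -> R}) :
  norm_from dot -> continuous (l : X -> R) ->
  exists v, forall h, l h = dot v h.
Proof.
move=> hilbert lc.
have [C C0 lC] : exists2 C : R, 0 < C & forall x, `|l x| <= C * `|x|.
  have /linear_boundedP/pinfty_ex_gt0 [C C0 h] := continuous_linear_bounded 0 (lc 0).
  by exists C.
pose J (v : X) : R := `|v| ^+ 2 - 2 * l v.
have Jlb v : - C ^+ 2 <= J v.
  have := lC v; rewrite ler_norml => /andP[_ h].
  by have := sqr_ge0 (`|v| - C); rewrite /J; nra.
have infJ : has_inf (range J).
  by split; [exists (J 0), 0|exists (- C ^+ 2) => _ [v _ <-]].
pose m := inf (range J).
have Jm v : m <= J v by apply: ge_inf; [case: infJ|exists v].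
(* The midpoint of [u] and [v] cannot have energy below [m], so two near-minimisers are close to
   each other. *)
have JB u v : `|u - v| ^+ 2 <= 2 * J u + 2 * J v - 4 * m.
  have := Jm (2^-1 *: (u + v)).
  have -> : J (2^-1 *: (u + v)) =
       `|u + v| ^+ 2 / 4 - l u - l v.
    rewrite /J; have -> : l (2^-1 *: (u + v)) = 2^-1 * (l u + l v).
      by rewrite [LHS]linearZ [in LHS]linearD.
    by rewrite normrZ exprMn ger0_norm//; field.
  rewrite /J.
  have := parallelogram hilbert u v.
  set a := `|u + v| ^+ 2; set b := `|u - v| ^+ 2.
  by move=> h1 h2; lra.
have /choice[w wm] (n : nat) : exists v, J v < m + n.+1%:R^-1.
  have n0 : 0 < n.+1%:R^-1 :> R by rewrite invr_gt0.
  by have [_ [v _ <-] h] := inf_adherent n0 infJ; exists v.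

have wB n k : (n <= k)%N -> `|w n - w k| ^+ 2 <= 4 * n.+1%:R^-1.
  move=> nk; have := JB (w n) (w k); have := wm n; have := wm k.
  have : k.+1%:R^-1 <= n.+1%:R^-1 :> R by rewrite lef_pV2 ?posrE// ler_nat.
  move: (k.+1%:R^-1) (n.+1%:R^-1) => a b; move: (J _) (J _) => c d.
  by lra.
have wc : cvg (w @ \oo).
  apply/cauchy_cvgP/cauchy_exP => e e0.
  have e2 : 0 < e ^+ 2 / 4 by rewrite divr_gt0 ?exprn_gt0.
  have [N hN] : exists N : nat, N.+1%:R^-1 < e ^+ 2 / 4.
    exists (Num.truncn (e ^+ 2 / 4)^-1); rewrite invf_plt ?posrE//.
    exact: truncnS_gt.
  exists (w N); exists N => // n /= Nn; rewrite -ball_normE /=.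
  rewrite -(@ltr_pXn2r _ 2)// ?nnegrE// ?ltW//.
  move: (wB _ _ Nn) hN; move: (N.+1%:R^-1) => a. lra.
pose v := lim (w @ \oo).
have Jv : J v <= m.
  have Jc : J (w n) @[n --> \oo] --> J v.
    apply: cvgB.
      by rewrite expr2; under eq_fun do rewrite expr2; apply: cvgM; apply: cvg_norm.
    by apply: cvgMr; apply: continuous_cvg => //; exact: lc.
  have mc : m + n.+1%:R^-1 @[n --> \oo] --> m.
    by rewrite -[X in _ --> X]addr0; apply: cvgD; [exact: cvg_cst|exact: cvg_harmonic].
  by apply: ler_cvg_to Jc mc _; apply: nearW => n; exact/ltW.
exists v => h; apply/eqP; rewrite -subr_eq0.
set D := l h - dot v h.
have tD t : 2 * t * D <= t ^+ 2 * `|h| ^+ 2.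
  have := le_trans Jv (Jm (v + t *: h)).
  rewrite /J (normD_sqr hilbert) normrZ exprMn real_normK ?num_real// dotZr.
  have -> : l (v + t *: h) = l v + t * l h by rewrite [LHS]linearD [in LHS]linearZ.
  by rewrite /D; lra.
have [h0|h0] := eqVneq `|h| 0.
  by have := tD D; rewrite h0 -sqrf_eq0 eq_le sqr_ge0; lra.
have hp : 0 < `|h| ^+ 2 by rewrite exprn_gt0// lt_neqAle eq_sym h0 normr_ge0.
have h1 : D ^+ 2 / `|h| ^+ 2 <= 0.
  (* This value of [t] maximises [2 * t * D - t ^+ 2 * |h| ^+ 2]. *)
  have := tD (D / `|h| ^+ 2).
  have -> : D ^+ 2 / `|h| ^+ 2 =
     2 * (D / `|h| ^+ 2) * D - (D / `|h| ^+ 2) ^+ 2 * `|h| ^+ 2 by field.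
  by rewrite subr_le0.
move: h1; rewrite pmulr_lle0 ?invr_gt0// => h1.
by rewrite -sqrf_eq0 eq_le h1 sqr_ge0.
Qed.

(** * Gradients and first-order expansions *)

Section gradient_expansion.
Context {R : realType} {X : normedModType R} (dot : {dot X for idfun}).
Context (hilbert : norm_from dot).

Lemma grad_unique (F : X -> R) x v :
  (forall h, 'd F x h = dot v h) -> grad dot F x = v.
Proof.
move=> Fv; apply: (dot_injective hilbert) => h.
have := @getPex _ [set v | forall h, 'd F x h = dot v h] (ex_intro _ v Fv) h.
by rewrite /grad Fv => <-.
Qed.

Lemma differentiable_of_expansion (F : X -> R) (k : R -> R) x v :
  k t @[t --> 0^'+] --> 0 ->
  (forall h, `|F (x + h) - F x - dot v h| <= `|h| * k `|h|) ->
  differentiable F x /\ grad dot F x = v.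
Proof.
move=> k0 Fk.
have lin : linear (dot v : X -> R).
  by move=> a y z; rewrite dotDr dotZr.
pose df : {linear X -> R} :=
  HB.pack (dot v : X -> R) (GRing.isLinear.Build R X R *:%R (dot v) lin).
have dfc : continuous df by exact: dot_continuous hilbert v.
have exp : F \o shift x = cst (F x) + df +o_ 0 id.
  apply/eqaddoP => e e0.
  have /nbhs_norm0P[d /= d0 kd] : \forall t \near 0^'+, `|k t| <= e.
    by move/cvgr0_norm_le : k0 => /(_ _ e0).
  apply/nbhs_norm0P; exists d => //= h hd.
  (* The limit from the right says nothing about [k 0]. *)
  have [->|h0] := eqVneq h 0.
    by rewrite !fctE /= add0r dot0r addr0 subrr !normr0 mulr0.
  rewrite !fctE /= [h + x]addrC opprD addrA (le_trans (Fk h))//.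
  rewrite mulrC ler_wpM2r// (le_trans (ler_norm _))//.
  by apply: kd; rewrite ?normr_gt0//= normr_id.
have dE := diff_unique dfc exp.
split; last by apply: grad_unique => h; rewrite dE.
by apply/diff_locallyP; rewrite dE.
Qed.

(** Convexity bounds the difference quotients with [0 < t < 1] by the one at [t = 1]; their limit at
    [0] is the directional derivative. *)
Lemma convex_above_diff (F : X -> R) x h : convex_function setT F ->
  differentiable F x -> F x + 'd F x h <= F (x + h).
Proof.
move=> /convex_functionP cF dF.
rewrite -lerBrDl -(deriveE h dF).
have /cvg_dnbhs_at_right Dh : t^-1 *: (F (t *: h + x) - F x) @[t --> 0^'] -->
    'D_h F x by exact: (diff_derivable dF).
apply: (ler_cvg_to Dh (cvg_cst (F (x + h) - F x))).
near=> t.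
have t0 : 0 < t by near: t; exact: nbhs_right_gt.
have t1 : t < 1 by near: t; exact: nbhs_right_lt.
have := cF t (x + h) x (ltW t0) (ltW t1).
have -> : t *: (x + h) + (1 - t) *: x = t *: h + x.
  by rewrite scalerDr addrAC -scalerDl addrC [t + _]addrC subrK scale1r.
rewrite -[t^-1 *: _]/(t^-1 * (F (t *: h + x) - F x)) ler_pdivrMl//.
by lra.
Unshelve. all: by end_near. Qed.

End gradient_expansion.

(** Continuity of the differential and [riesz] provide a representative, so the choice made in
    [grad] is a genuine one and not a default value. *)
Lemma grad_diff (R : realType) (X : completeNormedModType R)
    (dot : {dot X for idfun}) (F : X -> R) x :
  norm_from dot -> differentiable F x ->
  forall h, 'd F x h = dot (grad dot F x) h.
Proof.
move=> hilbert dF.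
have [v Fv] := riesz hilbert (diff_continuous dF).
by apply: (@getPex _ [set v | forall h, 'd F x h = dot v h]); exists v.
Qed.

Lemma half_double (R : realType) (V : lmodType R) (u : V) : 2^-1 *: (u + u) = u.
Proof. by rewrite scalerDr -scalerDl -[RHS]scale1r; congr (_ *: _); field. Qed.

(** * Differentiability of a convex function with small second differences *)

Section second_difference.
Context {R : realType} {X : completeNormedModType R} (dot : {dot X for idfun}).
Context (hilbert : norm_from dot).
Context (F : X -> R) (cF : convex_function setT F).
Context (k : R -> R) (k0 : k t @[t --> 0^'+] --> 0).
Context (x : X).
Context (Fk : forall h, F (x + h) + F (x - h) - 2 * F x <= `|h| * k `|h|).
Context (C : R) (FC : forall h, `|h| <= 1 -> F (x + h) <= C).

Let q h t := t^-1 * (F (x + t *: h) - F x).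
(** The one-sided directional derivative at [x]: difference quotients of a convex function are
    monotone in [t], so their limit at [0^'+] is an infimum. *)
Let p h := inf [set q h t | t in [set t | 0 < t]].

Let qmono h s t : 0 < s -> s <= t -> q h s <= q h t.
Proof.
move=> s0 st; have t0 : 0 < t by rewrite (lt_le_trans s0).
have := (convex_functionP F).1 cF (s / t) (x + t *: h) x.
have -> : s / t *: (x + t *: h) + (1 - s / t) *: x = x + s *: h.
  rewrite scalerDr addrAC -scalerDl scalerA divfK ?gt_eqF//.
  by rewrite [s / t + _]addrC subrK scale1r.
move=> /(_ _ _)/wrap[||h1].
- by rewrite divr_ge0// ltW.
- by rewrite ler_pdivrMr// mul1r.
rewrite /q ler_pdivrMl//.
have -> : s * (t^-1 * (F (x + t *: h) - F x)) =
  s / t * F (x + t *: h) + (1 - s / t) * F x - F x by ring.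
by lra.
Qed.

Let qN h t : 0 < t -> - q (- h) t <= q h t.
Proof.
move=> t0; have := (convex_functionP F).1 cF 2^-1 (x + t *: h) (x + t *: - h).
have -> : 2^-1 *: (x + t *: h) + (1 - 2^-1) *: (x + t *: - h) = x.
  have -> : 1 - 2^-1 = 2^-1 :> R by field.
  rewrite -scalerDr addrACA -scalerDr subrr scaler0 addr0.
  exact: half_double.
move=> /(_ _ _)/wrap[||h1]; [lra|lra|].
by rewrite /q -mulrN ler_pM2l ?invr_gt0//; lra.
Qed.

(** Bounds the quotients from below uniformly in [t], by the slope in the opposite direction; the
    infimum [p h] is therefore finite. *)
Let qlb h t : 0 < t -> - q (- h) 1 <= q h t.
Proof.
move=> t0; have [t1|/ltW t1] := leP t 1.
  by apply: le_trans (qN h t0); rewrite lerN2 qmono.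
exact: le_trans (qN h ltr01) (qmono h ltr01 t1).
Qed.

Let p_inf h : has_inf [set q h t | t in [set t | 0 < t]].
Proof.
split; first by exists (q h 1), 1 => //=.
by exists (- q (- h) 1) => _ [t t0 <-]; exact: qlb.
Qed.

Let p_le h t : 0 < t -> p h <= q h t.
Proof. by move=> t0; apply: ge_inf; [case: (p_inf h)|exists t]. Qed.

Let p_ge h c : (forall t, 0 < t -> c <= q h t) -> c <= p h.
Proof.
move=> hc; apply: lb_le_inf; first by case: (p_inf h).
by move=> _ [t t0 <-]; exact: hc.
Qed.

Let pD_le h h' : p (h + h') <= p h + p h'.
Proof.
rewrite -lerBlDr; apply: p_ge => s s0; rewrite lerBlDr -lerBlDl.
apply: p_ge => t t0; rewrite lerBlDl.
(* At the common step [m], midpoint convexity bounds the quotient of [h + h'] at [m / 2] by the sum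
   of the quotients of [h] and [h'] at [m]. *)
pose m := Num.min s t; have m0 : 0 < m by rewrite lt_min s0.
have m2 : 0 < m / 2 by rewrite divr_gt0.
apply: le_trans (lerD (qmono h m0 _) (qmono h' m0 _)); last 2 first.
- by rewrite ge_min lexx.
- by rewrite ge_min lexx orbT.
apply: le_trans (p_le _ m2) _.
have := (convex_functionP F).1 cF 2^-1 (x + m *: h) (x + m *: h').
have -> : 2^-1 *: (x + m *: h) + (1 - 2^-1) *: (x + m *: h') =
    x + (m / 2) *: (h + h').
  have -> : 1 - 2^-1 = 2^-1 :> R by field.
  rewrite -scalerDr addrACA -[m *: h + _]scalerDr [LHS]scalerDr scalerA [2^-1 * m]mulrC.
  by rewrite half_double.
move=> /(_ _ _)/wrap[||h1]; [lra|lra|].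
rewrite /q -mulrDr invfM invrK [m^-1 * 2]mulrC -mulrA [2 * _]mulrCA.
by rewrite ler_pM2l ?invr_gt0//; lra.
Qed.

Let p0 : p 0 = 0.
Proof.
have q0 t : q 0 t = 0 by rewrite /q scaler0 addr0 subrr mulr0.
apply: le_anti; rewrite -{1}(q0 1) p_le//=.
by apply: p_ge => t _; rewrite q0.
Qed.

(** By [Fk], [p h + p (- h)] is at most [|h| * k (t * |h|)] for every [t > 0], which tends to [0];
    the reverse inequality is subadditivity. Oddness is what turns the sublinear [p] into a linear
    form. *)
Let pN h : p (- h) = - p h.
Proof.
apply/eqP; rewrite eq_sym -subr_eq0 -opprD oppr_eq0 eq_le; apply/andP; split.
  have [->|h0] := eqVneq h 0; first by rewrite oppr0 p0 addr0.
  have nh : 0 < `|h| by rewrite normr_gt0.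
  have kc : `|h| * k (t * `|h|) @[t --> 0^'+] --> 0.
    rewrite -[X in _ --> X](mulr0 `|h|); apply: cvgMr.
    apply/cvgr0Pnorm_le => e e0.
    have /nbhs_norm0P[d /= d0 kd] : \forall t \near 0^'+, `|k t| <= e.
      by move/cvgr0_norm_le : k0 => /(_ _ e0).
    near=> t; have t0 : 0 < t by near: t; exact: nbhs_right_gt.
    apply: kd; last by rewrite mulr_gt0.
    rewrite /= gtr0_norm ?mulr_gt0// -ltr_pdivlMr//.
    by near: t; apply: nbhs_right_lt; rewrite divr_gt0.
  apply: (ler_cvg_to (cvg_cst (p h + p (- h))) kc).
  near=> t; have t0 : 0 < t by near: t; exact: nbhs_right_gt.
  apply: le_trans (lerD (p_le _ t0) (p_le _ t0)) _.
  rewrite /q -mulrDr ler_pdivrMl// mulrA.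
  have := Fk (t *: h); rewrite normrZ (gtr0_norm t0) scalerN; lra.
by rewrite -p0 -(subrr h) pD_le.
Unshelve. all: by end_near. Qed.

Let pD h h' : p (h + h') = p h + p h'.
Proof.
apply: le_anti; rewrite pD_le/= -lerBrDr -pN.
by rewrite -[X in p X <= _](addrK h') pD_le.
Qed.

Let pZ_gt0 a h : 0 < a -> p (a *: h) = a * p h.
Proof.
have le_pZ b u : 0 < b -> b * p u <= p (b *: u).
  move=> b0; apply: p_ge => t t0; rewrite -ler_pdivlMl//.
  apply: le_trans (p_le u (mulr_gt0 t0 b0)) _.
  by rewrite /q scalerA invfM mulrA [b^-1 * _]mulrC.
move=> a0; apply: le_anti; rewrite le_pZ// andbT.
have := le_pZ a^-1 (a *: h); rewrite invr_gt0 => /(_ a0).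
by rewrite scalerA mulVf ?gt_eqF// scale1r ler_pdivrMl.
Qed.

Let pZ a h : p (a *: h) = a * p h.
Proof.
have [a0|a0|->] := ltgtP a 0; last by rewrite scale0r p0 mul0r.
- by rewrite -[a]opprK scaleNr pN pZ_gt0 ?mulNr// oppr_gt0.
- exact: pZ_gt0.
Qed.

Let q1 h : q h 1 = F (x + h) - F x.
Proof. by rewrite /q invr1 mul1r scale1r. Qed.

(** [p] is linear and, by [FC], bounded on the unit ball, so [riesz] represents it. The lower bound
    is [p h <= q h 1]; the same bound for [- h], added to [Fk], gives the upper one. *)
Lemma convex_expansion :
  exists v, forall h, 0 <= F (x + h) - F x - dot v h <= `|h| * k `|h|.
Proof.
have plin : linear (p : X -> R) by move=> a h h'; rewrite pD pZ.
pose l : {linear X -> R} :=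
  HB.pack (p : X -> R) (GRing.isLinear.Build R X R *:%R p plin).
have pC h : `|h| <= 1 -> p h <= C - F x.
  by move=> h1; rewrite (le_trans (p_le _ ltr01))// q1 lerD2r FC.
have lc : continuous l.
  apply: bounded_linear_continuous; exists (C - F x); split; first exact: num_real.
  move=> c cC; apply/nbhs_norm0P; exists 1 => //= h /= h1.
  rewrite (le_trans _ (ltW cC))// ler_norml.
  by rewrite lerNl -[- l h]/(- p h) -pN pC ?normrN ?pC// ltW.
have [v lv] := riesz hilbert lc.
exists v => h; rewrite -lv -[l h]/(p h).
rewrite subr_ge0 -q1 p_le//= q1.
have := p_le (- h) ltr01; rewrite pN q1; have := Fk h; lra.
Qed.

End second_difference.

(** * Extended real suprema with value [0] on the empty set *)

Section supremum_ereal.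
Context {R : realType}.
Implicit Types (S : set (\bar R)) (c r : \bar R).

(** [ereal_sup] is the supremum with default [-oo], so the two can differ only on the empty set. *)
Lemma supremum_ereal_sup S : S !=set0 -> supremum 0%E S = ereal_sup S.
Proof.
move=> S0; have Sn0 : S == set0 = false by apply/negbTE/set0P.
have [y Sy] := ereal_supremums_neq0 S.
rewrite /ereal_sup /supremum Sn0.
by rewrite !(xget_subset1 _ Sy)//; exact: is_subset1_supremums.
Qed.

Lemma supremum_le S c : (0 <= c)%E -> (forall r, S r -> (r <= c)%E) ->
  (supremum 0 S <= c)%E.
Proof.
move=> c0 Sc; have [->|/set0P S0] := eqVneq S set0; first by rewrite supremum0.
by rewrite supremum_ereal_sup//; apply: ge_ereal_sup => r /Sc.
Qed.

Lemma supremum_ge S r : S r -> (r <= supremum 0 S)%E.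
Proof.
by move=> Sr; rewrite supremum_ereal_sup; [exact: ereal_sup_ubound|exists r].
Qed.

Lemma supremum_ge0 S : (forall r, S r -> (0 <= r)%E) -> (0 <= supremum 0 S)%E.
Proof.
move=> S0; have [->|/set0P[r Sr]] := eqVneq S set0; first by rewrite supremum0.
by rewrite (le_trans (S0 r Sr))// supremum_ge.
Qed.

End supremum_ereal.

(** * Consequences of a two-sided expansion: gradient estimates and the jet inequality *)

Section expansion.
Context {R : realType} {X : normedModType R} (dot : {dot X for idfun}).
Context (hilbert : norm_from dot).
Context (omega : R -> R) (om_mod : modulus_of_continuity omega).
Context (F : X -> R) (v : X -> X) (A : R) (A0 : 0 <= A).
Context (Fv : forall x h,
  0 <= F (x + h) - F x - dot (v x) h <= A * phi omega `|h|).

Let Fge x y : F x + dot (v x) (y - x) <= F y.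
Proof.
by have /andP[+ _] := Fv x (y - x); rewrite [x + _]addrC subrK; lra.
Qed.

Let Fle x h s : `|h| <= s -> F (x + h) <= F x + dot (v x) h + A * phi omega s.
Proof.
move=> hs; have /andP[_ h1] := Fv x h.
have : A * phi omega `|h| <= A * phi omega s.
  by rewrite ler_wpM2l// (phi_le om_mod).
by lra.
Qed.

(** The unit vector along [D], or [0] when [D = 0]; the facts below cover both cases. *)
Let dir (D : X) := `|D|^-1 *: D.

Let dirE D : dot D (dir D) = `|D|.
Proof.
rewrite /dir dotZr -hilbert; have [->|D0] := eqVneq `|D| 0.
  by rewrite expr0n mulr0.
by rewrite expr2 mulrA mulVf// mul1r.
Qed.

Let norm_dir_le D s : 0 <= s -> `|s *: dir D| <= s.
Proof.
move=> s0; rewrite /dir !normrZ ger0_norm// ger0_norm ?invr_ge0//.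
have [->|D0] := eqVneq `|D| 0; first by rewrite mulr0 mulr0.
by rewrite mulVf// mulr1.
Qed.

Let dirNle D s : 0 <= s -> `|- (s *: dir D)| <= s.
Proof. by move=> s0; rewrite normrN norm_dir_le. Qed.

(** At the point [x - s *: dir (v x - v z)], [F] is bounded below by its tangent at [z] and above by
    its expansion at [x]. *)
Let le_tangents x z s : 0 <= s ->
  F z + dot (v z) (x - z) + s * `|v x - v z| <= F x + A * phi omega s.
Proof.
move=> s0; set D := v x - v z.
have h1 := le_trans (Fge z (x - s *: dir D)) (Fle x (dirNle D s0)).
move: h1; rewrite [x - _ - z]addrAC dotBr dotNr !(dotZr dot s).
by have := dirE D; rewrite {1}/D dotBl => <-; lra.
Qed.

Lemma gradient_modulus x z : `|v x - v z| <= 4 / 3 * A * omega `|x - z|.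
Proof.
have [->|xz] := eqVneq x z.
  by rewrite !subrr !normr0 (modulus0 om_mod) mulr0.
have d0 : 0 < `|x - z| by rewrite normr_gt0 subr_eq0.
(* With [d = |x - z|], adding the two instances of [le_tangents] gives [|v x - v z| * (2 * s - d) <=
   2 * A * phi s]. At [s = 2 * d], [phi_double_le] makes this [3 * d * |v x - v z| <= 4 * A * d *
   omega d]. *)
have s0 : 0 <= 2 * `|x - z| by rewrite mulr_ge0.
have h1 := le_tangents x z s0; have h2 := le_tangents z x s0.
have h3 := dot_le_norm hilbert (v x - v z) (x - z).
have h4 : A * phi omega (2 * `|x - z|) <= A * (2 * `|x - z| * omega `|x - z|).
  by rewrite ler_wpM2l// (phi_double_le om_mod).
move: h2; rewrite [`|v z - _|]distrC -opprB dotNr => h2.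
rewrite dotBl in h3; rewrite -(ler_pM2l d0); lra.
Qed.

Lemma gradient_continuous : continuous v.
Proof.
move=> x; apply/cvgrPdist_lt => e e0.
pose c := 4 / 3 * A + 1; have c0 : 0 < c by rewrite ltr_wpDl// mulr_ge0.
have om0 : omega t @[t --> 0^'+] --> 0 by case: om_mod.
have ec : 0 < e / c by rewrite divr_gt0.
have /nbhs_norm0P[d /= d0 kd] : \forall t \near 0^'+, `|omega t| < e / c.
  by move/cvgr0_norm_lt : om0 => /(_ _ ec).
have : \forall y \near x, `|x - y| < d by apply: cvgr_dist_lt.
apply: filterS => y xy.
have [->|/eqP nxy] := eqVneq x y; first by rewrite subrr normr0.
have d1 : 0 < `|x - y| by rewrite normr_gt0 subr_eq0; exact/eqP.
have h : omega `|x - y| < e / c.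
  by apply: le_lt_trans (ler_norm _) _; apply: kd; rewrite //= normr_id.
apply: le_lt_trans (gradient_modulus x y) _.
apply: (@le_lt_trans _ _ (c * omega `|x - y|)).
  by rewrite ler_wpM2r ?(modulus_ge0 om_mod)// lerDl.
by rewrite mulrC -ltr_pdivlMr.
Qed.

Lemma gradient_expansion x : differentiable F x /\ grad dot F x = v x.
Proof.
apply: (differentiable_of_expansion hilbert (k := fun t => A * omega t)).
  rewrite -[X in _ --> X](mulr0 A); apply: cvgMr; by case: om_mod.
move=> h; have /andP[h1 h2] := Fv x h.
rewrite ger0_norm// (le_trans h2)// mulrCA ler_wpM2l//.
exact: (phi_le_mul om_mod).
Qed.

Let gradE : grad dot F = v.
Proof. by apply/funext => x; case: (gradient_expansion x). Qed.

Lemma lip_omega_grad_le :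
  (lip_omega omega (grad dot F) setT <= (4 / 3 * A)%:E)%E.
Proof.
rewrite gradE; apply: supremum_le; first by rewrite lee_fin mulr_ge0.
move=> _ [x [z [_ _ xz ->]]]; rewrite lee_fin.
have := gradient_modulus x z.
(* If the denominator vanishes, the quotient is [0] because [0^-1 = 0]. *)
have [->|w0] := eqVneq (omega `|x - z|) 0.
  by move=> _; rewrite invr0 mulr0 mulr_ge0.
by rewrite ler_pdivrMr// lt_neqAle eq_sym w0 (modulus_ge0 om_mod).
Qed.

Lemma C1_omega_of_expansion : C1_omega dot omega F.
Proof.
split; first by move=> x; case: (gradient_expansion x).
- rewrite gradE; exact: gradient_continuous.
- exact: le_lt_trans lip_omega_grad_le (ltry _).
Qed.

Lemma A_co_le : (A_co dot omega F (grad dot F) setT <= A%:E)%E.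
Proof.
rewrite gradE; apply: supremum_le; first by rewrite lee_fin.
move=> _ [y [z [x [_ _ xy ->]]]]; rewrite lee_fin.
have h : F z + dot (v z) (x - z) - F y - dot (v y) (x - y)
    <= A * phi omega `|x - y|.
  have /andP[_ +] := Fv y (x - y); rewrite [y + _]addrC subrK.
  by have := Fge z x; lra.
have [p0|p0] := eqVneq (phi omega `|x - y|) 0; first by rewrite p0 invr0 mulr0.
by rewrite ler_pdivrMr// lt_neqAle eq_sym p0 (phi_ge0 om_mod).
Qed.

(** [le_tangents] holds for every [s >= 0]; after division by [A], the supremum over [s] produces
    the Fenchel conjugate. *)
Lemma star_of_expansion x z : 0 < A ->
  F z + dot (v z) (x - z) + A * fenchel_conj (phi omega) (A^-1 * `|v x - v z|)
  <= F x.
Proof.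
move=> Ap; rewrite -lerBrDl -ler_pdivlMl//.
apply: ge_sup.
  by exists (A^-1 * `|v x - v z| * 0 - phi omega 0); exists 0; rewrite //= in_itv/= lexx.
move=> r [s /=]; rewrite in_itv/= andbT => s0 <-.
rewrite ler_pdivlMl//; have := le_tangents x z s0.
have -> : A * (A^-1 * `|v x - v z| * s - phi omega s) =
  s * `|v x - v z| - A * phi omega s by field; rewrite gt_eqF.
by lra.
Qed.

End expansion.

(** Immediate once the supremum is finite, which is where the growth of [omega] enters: beyond an
    [r0] with [t <= omega r0], the function [t * r - phi r] stays below its value at [r0]. *)
Lemma fenchel_young (R : realType) (omega : R -> R) (s t : R) :
  modulus_of_continuity omega -> omega r @[r --> +oo] --> +oo -> 0 <= s ->
  t * s <= phi omega s + fenchel_conj (phi omega) t.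
Proof.
move=> om_mod omega_oo s0.
have [r0 [r0_ge0 hr0]] : exists r0, 0 <= r0 /\ t <= omega r0.
  have h : \forall r \near +oo, t <= omega r by move/cvgryPge : omega_oo => /(_ t).
  near +oo_R => r; exists r; split; first by near: r; exact: nbhs_pinfty_ge.
  by near: r.
have ub : has_ubound [set t * r - phi omega r | r in `[0, +oo[].
  exists (`|t| * r0) => _ [r /= + <-]; rewrite in_itv/= andbT => r_ge0.
  have p_ge0 := phi_ge0 om_mod r_ge0; have tr := ler_norm t.
  have [rr0|/ltW r0r] := leP r r0.
    have h1 : t * r <= `|t| * r by rewrite ler_wpM2r.
    have h2 : `|t| * r <= `|t| * r0 by rewrite ler_wpM2l.
    by lra.
  have /andP[h _] := phi_increment om_mod r0_ge0 r0r.
  have p0_ge0 := phi_ge0 om_mod r0_ge0.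
  have h1 : t * (r - r0) <= omega r0 * (r - r0) by rewrite ler_wpM2r// subr_ge0.
  have h2 : t * r0 <= `|t| * r0 by rewrite ler_wpM2r.
  by lra.
have : t * s - phi omega s <= fenchel_conj (phi omega) t.
  by apply: ub_le_sup => //; exists s; rewrite //= in_itv/= s0.
by lra.
Unshelve. all: by end_near. Qed.

(** * The envelope [g] and suprema of its convex minorants *)

Section upper_envelope.
Context {R : realType} {X : completeNormedModType R} (dot : {dot X for idfun}).
Context (hilbert : norm_from dot).
Context (omega : R -> R) (om_mod : modulus_of_continuity omega).
Context (omega_oo : omega t @[t --> +oo] --> +oo).
Context (E : set X) (E0 : E !=set0) (f : X -> R) (G : X -> X).
Context (M : R) (M0 : 0 < M) (star : cond_star dot omega E f G M).

Let g := upper_env dot omega E f G M.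
Let tangent z x := f z + dot (G z) (x - z).
Let upper y x := tangent y x + M * phi omega `|x - y|.

(** The slopes differ by [dot (G z - G y) (x - y)], at most [|G y - G z| * |x - y|]. Young's
    inequality splits this into [M * phi |x - y|], present in [upper], and the conjugate term,
    supplied by [star]. *)
Lemma tangent_le_upper y z x : E y -> E z -> tangent z x <= upper y x.
Proof.
move=> Ey Ez; have h1 := star Ey Ez.
have h2 := fenchel_young (M^-1 * `|G y - G z|) om_mod omega_oo (normr_ge0 (x - y)).
have h3 := dot_le_norm hilbert (G z - G y) (x - y).
have : M * (M^-1 * `|G y - G z| * `|x - y|) <=
    M * (phi omega `|x - y| + fenchel_conj (phi omega) (M^-1 * `|G y - G z|)).
  by rewrite ler_pM2l.
rewrite mulrA mulVKf ?gt_eqF// => h4.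
rewrite distrC dotBl in h3.
have e1 : dot (G z) (x - z) = dot (G z) (x - y) + dot (G z) (y - z).
  by rewrite -dotDr addrA subrK.
by rewrite /upper /tangent e1; lra.
Qed.

Lemma has_inf_upper_values x : has_inf (upper_values dot omega E f G M x).
Proof.
have [y0 Ey0] := E0; split; first by exists (upper y0 x); exists y0.
by exists (tangent y0 x) => _ [y Ey <-]; exact: tangent_le_upper.
Qed.

Lemma tangent_le_env z x : E z -> tangent z x <= g x.
Proof.
move=> Ez; apply: lb_le_inf; first by case: (has_inf_upper_values x).
by move=> _ [y Ey <-]; exact: tangent_le_upper.
Qed.

Lemma env_le_upper y x : E y -> g x <= upper y x.
Proof. by move=> Ey; apply: ge_inf; [case: (has_inf_upper_values x)|exists y]. Qed.

Lemma env_le y : E y -> g y <= f y.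
Proof.
move=> Ey; rewrite (le_trans (env_le_upper y Ey))// /upper /tangent.
by rewrite subrr normr0 (phi0 omega) dot0r mulr0 !addr0.
Qed.

(** One and the same [y] is tested at [x + a], [x - a] and [x]: the affine parts cancel and
    [phi_parallelogram] controls the rest. The inequality is first solved for [g x], so that the
    infimum over [y] can be taken. *)
Lemma env_second_difference x a :
  g (x + a) + g (x - a) <= 2 * g x + 2 * M * phi omega `|a|.
Proof.
suff : (g (x + a) + g (x - a) - 2 * M * phi omega `|a|) / 2 <= g x.
  by move: (g (x + a)) (g (x - a)) (g x) (phi omega `|a|) => p q r u; lra.
apply: lb_le_inf; first by case: (has_inf_upper_values x).
move=> _ [y Ey <-]; have h1 := env_le_upper (x + a) Ey.
have h2 := env_le_upper (x - a) Ey.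
rewrite -/(tangent y x) -/(upper y x).
have h3 : phi omega `|x + a - y| + phi omega `|x - a - y| <=
    2 * phi omega `|x - y| + 2 * phi omega `|a|.
  apply: (phi_parallelogram om_mod) => //.
  by rewrite [x + a - y]addrAC [x - a - y]addrAC (parallelogram hilbert).
have : M * (phi omega `|x + a - y| + phi omega `|x - a - y|) <=
    M * (2 * phi omega `|x - y| + 2 * phi omega `|a|) by rewrite ler_pM2l.
move: h1 h2; rewrite /upper /tangent [x + a - y]addrAC [x - a - y]addrAC.
rewrite dotBr dotDr; clear h3.
move: (g (x + a)) (g (x - a)) (dot (G y) (x - y)) (dot (G y) a) => p q d e.
by move: (phi _ _) (phi _ _) (phi _ _) (phi _ _) => u v w z; lra.
Qed.

(* [conv_env g] and [conv_env_lip L g] are the cases where [P] consists of the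
   convex continuous, resp. convex [L]-Lipschitz, functions. *)
Context (P : set (X -> R)).
Context (Pconvex : forall h, P h -> convex_function setT h).
Context (Pmid : forall h1 h2 a c, P h1 -> P h2 ->
  P (fun x => (h1 (x + a) + h2 (x - a) - c) / 2)).
Context (Ptangent : forall z, E z -> P (tangent z)).

Let F x := sup [set h x | h in [set h | P h /\ forall z, h z <= g z]].

Let F_sup x : has_sup [set h x | h in [set h | P h /\ forall z, h z <= g z]].
Proof.
split; last by exists (g x) => _ [h [_ hg] <-].
have [z Ez] := E0; exists (tangent z x); exists (tangent z) => //.
by split; [exact: Ptangent|move=> y; exact: tangent_le_env].
Qed.

Let F_ge h x : P h -> (forall z, h z <= g z) -> h x <= F x.
Proof. by move=> Ph hg; apply: ub_le_sup; [case: (F_sup x)|exists h]. Qed.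

Let F_le x c : (forall h, P h -> (forall z, h z <= g z) -> h x <= c) -> F x <= c.
Proof.
move=> hc; apply: ge_sup; first by case: (F_sup x).
by move=> _ [h [Ph hg] <-]; exact: hc.
Qed.

Let F_le_env x : F x <= g x.
Proof. by apply: F_le. Qed.

Lemma sup_minorants_convex : convex_function setT F.
Proof.
apply/convex_functionP => t x y t0 t1; apply: F_le => h Ph hg.
apply: le_trans ((convex_functionP h).1 (Pconvex Ph) t x y t0 t1) _.
by rewrite lerD// ler_wpM2l ?subr_ge0// F_ge.
Qed.

Let F_second_difference x a :
  F (x + a) + F (x - a) - 2 * F x <= 2 * M * phi omega `|a|.
Proof.
set c := 2 * M * phi omega `|a|.
(* The suprema at [x + a] and [x - a] are replaced one at a time, since the minorants [h1] and [h2]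
   chosen there are unrelated. *)
suff : F (x + a) <= 2 * F x + c - F (x - a) by lra.
apply: F_le => h1 Ph1 h1g.
suff : F (x - a) <= 2 * F x + c - h1 (x + a) by lra.
apply: F_le => h2 Ph2 h2g.
have := F_ge x (Pmid a c Ph1 Ph2); move=> /(_ _)/wrap[z|/=]; last by lra.
have := env_second_difference z a; rewrite -/c.
have := h1g (z + a); have := h2g (z - a).
move: (g (z + a)) (g (z - a)) (g z) (h1 (z + a)) (h2 (z - a)) c => p q r u v w.
by lra.
Qed.

Lemma sup_minorants_expansion : exists v, forall x h,
  0 <= F (x + h) - F x - dot (v x) h <= 2 * M * phi omega `|h|.
Proof.
suff /choice[v vF] : forall x, exists v, forall h,
    0 <= F (x + h) - F x - dot v h <= 2 * M * phi omega `|h|.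
  by exists v; exact: vF.
move=> x; have [y Ey] := E0.
have k0 : 2 * M * omega t @[t --> 0^'+] --> 0.
  by rewrite -[X in _ --> X](mulr0 (2 * M)); apply: cvgMr; case: om_mod.
have M2 : 0 <= 2 * M by rewrite mulr_ge0// ltW.
(* The weaker bound with [t * omega t] has the form that [convex_expansion] takes; the bound with
   [phi] is recovered at the end from the lower expansion at [- h]. *)
have Fk h : F (x + h) + F (x - h) - 2 * F x <= `|h| * (2 * M * omega `|h|).
  apply: le_trans (F_second_difference x h) _.
  by rewrite mulrCA ler_wpM2l// (phi_le_mul om_mod).
pose r := `|x - y| + 1.
have FC h : `|h| <= 1 -> F (x + h) <= f y + (`|G y| * r + M * phi omega r).
  move=> h1; apply: le_trans (F_le_env _) (le_trans (env_le_upper _ Ey) _).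
  have hr : `|x + h - y| <= r.
    by rewrite addrAC (le_trans (ler_normD _ _))// lerD2l.
  rewrite /upper /tangent -addrA lerD2l lerD//.
    by rewrite (le_trans (dot_le_norm hilbert _ _))// ler_wpM2l.
  by rewrite ler_pM2l// (phi_le om_mod).
have [v hv] := convex_expansion hilbert sup_minorants_convex k0 Fk FC.
exists v => h; have /andP[h1 h2] := hv h; have /andP[h3 h4] := hv (- h).
rewrite h1 /=; have := F_second_difference x h.
rewrite dotNr in h3; move: h3 => {h1 h2 h4 hv}.
move: (F (x + h)) (F (x - h)) (F x) (dot v h) (phi omega _) => p q s d u.
by lra.
Qed.

(** For [z] in [E], [F] is squeezed between [tangent z] and [upper z], which agree at [z] and differ
    by [M * phi |h|] at [z + h]. *)
Lemma sup_minorants_extends : extends_jet dot E f G F.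
Proof.
move=> z Ez; have tF x : tangent z x <= F x.
  by apply: F_ge; [exact: Ptangent|move=> y; exact: tangent_le_env].
have Fz : F z = f z.
  apply: le_anti; rewrite (le_trans (F_le_env z) (env_le Ez))/=.
  by have := tF z; rewrite /tangent subrr dot0r addr0.
split=> //.
have k0 : M * omega t @[t --> 0^'+] --> 0.
  by rewrite -[X in _ --> X](mulr0 M); apply: cvgMr; case: om_mod.
have [] // := differentiable_of_expansion hilbert (F := F) (x := z) (v := G z) k0.
move=> h; have h1 := tF (z + h).
have h2 := le_trans (F_le_env _) (env_le_upper (z + h) Ez).
move: h1 h2; rewrite /upper /tangent [z + h - z]addrAC subrr add0r Fz => h1 h2.
have h3 : M * phi omega `|h| <= `|h| * (M * omega `|h|).
  by rewrite mulrCA ler_pM2l// (phi_le_mul om_mod).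
move: h1 h2 h3; move: (F (z + h)) (dot (G z) h) (phi _ _) (_ * (M * _)).
by move=> p q r u h1 h2 h3; rewrite ger0_norm; lra.
Qed.

End upper_envelope.

(** * Lipschitz and convexity criteria for minorants *)

Lemma klipschitzP (R : realType) (V W : normedModType R) (L : R) (h : V -> W) :
  L.-lipschitz h <-> forall x y, `|h x - h y| <= L * `|x - y|.
Proof.
split=> [hL x y|hL [x y] _]; last exact: hL.
by apply: (hL (x, y)).
Qed.

Lemma convex_function_affine (R : realType) (V : lmodType R) (h : V -> R) :
  (forall t x y, h (t *: x + (1 - t) *: y) = t * h x + (1 - t) * h y) ->
  convex_function setT h.
Proof. by move=> hE; apply/convex_functionP => t x y _ _; rewrite hE. Qed.

Lemma convex_midpoint (R : realType) (V : lmodType R) (h1 h2 : V -> R) a c :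
  convex_function setT h1 -> convex_function setT h2 ->
  convex_function setT (fun x => (h1 (x + a) + h2 (x - a) - c) / 2).
Proof.
move=> /convex_functionP c1 /convex_functionP c2; apply/convex_functionP.
move=> t x y t0 t1.
have shift b : t *: x + (1 - t) *: y + b = t *: (x + b) + (1 - t) *: (y + b).
  by rewrite !scalerDr addrACA -scalerDl [t + _]addrC subrK scale1r.
rewrite !shift.
by have := c1 t (x + a) (y + a) t0 t1; have := c2 t (x - a) (y - a) t0 t1; lra.
Qed.

(** * The two envelopes as smooth convex extensions *)

Section conclusions.
Context {R : realType} {X : completeNormedModType R} (dot : {dot X for idfun}).
Context (hilbert : norm_from dot).
Context (omega : R -> R) (om_mod : modulus_of_continuity omega).
Context (omega_oo : omega t @[t --> +oo] --> +oo).
Context (E : set X) (E0 : E !=set0) (f : X -> R) (G : X -> X).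
Context (M : R) (M0 : 0 < M) (star : cond_star dot omega E f G M).

Let g := upper_env dot omega E f G M.
Let tangent z x := f z + dot (G z) (x - z).

Let smooth_extension (F : X -> R) :=
  [/\ convex_function setT F, C1_omega dot omega F, extends_jet dot E f G F,
      (A_co dot omega F (grad dot F) setT <= (2 * M)%:E)%E
    & (lip_omega omega (grad dot F) setT <= (8 / 3 * M)%:E)%E].

Lemma tangent_convex z : convex_function setT (tangent z).
Proof.
apply: convex_function_affine => t x y; rewrite /tangent.
by rewrite !dotBr dotDr !dotZr; ring.
Qed.

Lemma tangent_lipschitz z x y : `|tangent z x - tangent z y| <= `|G z| * `|x - y|.
Proof.
have -> : tangent z x - tangent z y = dot (G z) (x - y).
  by rewrite /tangent !dotBr; ring.
exact: normr_dot_le.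
Qed.

Lemma sup_minorants_extension (P : set (X -> R)) :
  (forall h, P h -> convex_function setT h) ->
  (forall h1 h2 a c, P h1 -> P h2 ->
     P (fun x => (h1 (x + a) + h2 (x - a) - c) / 2)) ->
  (forall z, E z -> P (tangent z)) ->
  smooth_extension
    (fun x => sup [set h x | h in [set h | P h /\ forall z, h z <= g z]]).
Proof.
move=> Pc Pm Pt.
have M2 : 0 <= 2 * M by rewrite mulr_ge0// ltW.
have [v Fv] := sup_minorants_expansion hilbert om_mod omega_oo E0 M0 star Pc Pm Pt.
split.
- exact: (sup_minorants_convex hilbert om_mod omega_oo E0 M0 star Pc Pt).
- exact: (C1_omega_of_expansion hilbert om_mod M2 Fv).
- exact: (sup_minorants_extends hilbert om_mod omega_oo E0 M0 star Pt).
- exact: (A_co_le hilbert om_mod M2 Fv).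
- have := lip_omega_grad_le hilbert om_mod M2 Fv.
  (* The factor [4 / 3] of [gradient_modulus], taken at [A = 2 * M]. *)
  by rewrite mulrA (_ : 4 / 3 * 2 = 8 / 3 :> R)//; field.
Qed.

Lemma conv_env_extension : smooth_extension (conv_env g).
Proof.
have -> : conv_env g = fun x => sup [set h x | h in [set h |
    (convex_function setT h /\ continuous h) /\ forall z, h z <= g z]].
  apply/funext => x; congr (sup [set _ | h in _]).
  by apply/seteqP; split=> h /=; [case|case=> -[]].
apply: (sup_minorants_extension (P := [set h | _ /\ _])).
- by move=> h [].
- move=> h1 h2 a c [c1 k1] [c2 k2]; split; first exact: convex_midpoint.
  have kS (h : X -> R) b : continuous h -> continuous (fun x => h (x + b)).
    move=> hc x; apply: (@continuous_comp _ _ _ (fun x => x + b) h); last exact: hc.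
    by apply: cvgD; [exact: cvg_id|exact: cvg_cst].
  move=> x; apply: cvgMl; apply: cvgB; last exact: cvg_cst.
  by apply: cvgD; exact: kS.
- move=> z _; split; first exact: tangent_convex.
  apply: continuous_of_lipschitz => x y; exact: tangent_lipschitz.
Qed.

Lemma conv_env_lip_extension L : (forall z, E z -> `|G z| <= L) ->
  smooth_extension (conv_env_lip L g).
Proof.
move=> GL; have -> : conv_env_lip L g = fun x => sup [set h x | h in [set h |
    (convex_function setT h /\ L.-lipschitz h) /\ forall z, h z <= g z]].
  apply/funext => x; congr (sup [set _ | h in _]).
  by apply/seteqP; split=> h /=; [case|case=> -[]].
apply: (sup_minorants_extension (P := [set h | _ /\ _])).
- by move=> h [].
- move=> h1 h2 a c [c1 /klipschitzP k1] [c2 /klipschitzP k2].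
  split; first exact: convex_midpoint.
  apply/klipschitzP => x y; have := k1 (x + a) (y + a); have := k2 (x - a) (y - a).
  have sub b : x + b - (y + b) = x - y by rewrite opprD addrACA subrr addr0.
  rewrite !sub !ler_norml => /andP[? ?] /andP[? ?].
  by apply/andP; split; lra.
- move=> z Ez; split; first exact: tangent_convex.
  apply/klipschitzP => x y; rewrite (le_trans (tangent_lipschitz z x y))//.
  by rewrite ler_wpM2r// GL.
Qed.

Let affineE z x : dot (G z) x + (f z - dot (G z) z) = tangent z x.
Proof. by rewrite /tangent dotBr; ring. Qed.

(** The tangent at any point of [E] serves, so [conv_env g] is a supremum over a nonempty set. *)
Lemma env_continuous_affine_minorant : has_continuous_affine_minorant g.
Proof.
have [z Ez] := E0.
have lin : GRing.linear_for *%R (dot (G z) : X -> R).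
  by move=> a y y'; rewrite dotDr dotZr.
pose l : {scalar X} :=
  HB.pack (dot (G z) : X -> R) (GRing.isLinear.Build R X R *%R (dot (G z)) lin).
exists l, (f z - dot (G z) z).
split; first exact: dot_continuous hilbert (G z).
by move=> x /=; rewrite affineE; exact: tangent_le_env.
Qed.

Lemma env_lipschitz_affine_minorant L : (forall z, E z -> `|G z| <= L) ->
  has_lipschitz_affine_minorant L g.
Proof.
move=> GL; have [z Ez] := E0.
have lin : GRing.linear_for *%R (dot (G z) : X -> R).
  by move=> a y y'; rewrite dotDr dotZr.
pose l : {scalar X} :=
  HB.pack (dot (G z) : X -> R) (GRing.isLinear.Build R X R *%R (dot (G z)) lin).
exists l, (f z - dot (G z) z).
split; last by move=> x /=; rewrite affineE; exact: tangent_le_env.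
apply/klipschitzP => x y /=; rewrite !affineE.
by rewrite (le_trans (tangent_lipschitz z x y))// ler_wpM2r// GL.
Qed.

Lemma conv_env_lip_lipschitz L x y : (forall z, E z -> `|G z| <= L) ->
  `|conv_env_lip L g x - conv_env_lip L g y| <= L * `|x - y|.
Proof.
move=> GL.
have tE z : E z -> [/\ convex_function setT (tangent z), L.-lipschitz (tangent z)
    & forall x, tangent z x <= g x].
  move=> Ez; split; first exact: tangent_convex.
    apply/klipschitzP => u w; rewrite (le_trans (tangent_lipschitz z u w))//.
    by rewrite ler_wpM2r// GL.
  by move=> u; exact: tangent_le_env.
have lip_le u w : conv_env_lip L g u <= conv_env_lip L g w + L * `|u - w|.
  apply: ge_sup.
    by have [z Ez] := E0; exists (tangent z u), (tangent z) => //; exact: tE.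
  move=> _ [h [hc hL hg] <-].
  have : h w <= conv_env_lip L g w.
    apply: ub_le_sup; last by exists h.
    by exists (g w) => _ [h' [_ _ h'g] <-].
  by have := (klipschitzP L h).1 hL u w; rewrite ler_norml => /andP[]; lra.
rewrite ler_norml; apply/andP; split.
  by have := lip_le y x; rewrite distrC; lra.
by have := lip_le x y; lra.
Qed.

End conclusions.

(** * Smooth convex functions: Lipschitz constants and necessity of the jet inequality *)

Section smooth_convex.
Context {R : realType} {X : completeNormedModType R} (dot : {dot X for idfun}).
Context (hilbert : norm_from dot).
Context (F : X -> R) (cF : convex_function setT F).
Context (dF : forall x, differentiable F x).

Lemma convex_above_tangent x h : F x + dot (grad dot F x) h <= F (x + h).
Proof. by rewrite -(grad_diff hilbert (dF x)) convex_above_diff. Qed.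

(** A step from [x] along the gradient [v] itself: convexity gives [|v| ^+ 2 <= F (x + v) - F x],
    which is at most [K * |v|]. *)
Lemma grad_norm_le x K : 0 <= K -> (forall y z, `|F y - F z| <= K * `|y - z|) ->
  `|grad dot F x| <= K.
Proof.
move=> K0 FK; set v := grad dot F x.
have [->|v0] := eqVneq `|v| 0; first by [].
have vp : 0 < `|v| by rewrite lt_neqAle eq_sym v0 normr_ge0.
rewrite -(ler_pM2r vp) -expr2 hilbert.
have := convex_above_tangent x v; have := FK (x + v) x.
rewrite [x + v]addrC addrK -/v => h1 h2.
by have := ler_norm (F (v + x) - F x); lra.
Qed.

(** A cycle of inequalities: [L] is at most the supremum of gradient norms over [X], this is at most
    [lip F setT] by [grad_norm_le], and that is at most [L]. *)
Lemma lip_grad L (E : set X) : E !=set0 ->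
  (forall x y, `|F x - F y| <= L * `|x - y|) ->
  has_ubound [set `|grad dot F z| | z in E] ->
  L = sup [set `|grad dot F z| | z in E] ->
  ereal_sup [set `|grad dot F x|%:E | x in setT] = lip F setT /\
  lip F setT = L%:E.
Proof.
move=> [z Ez] FL ub LE.
have L0 : 0 <= L.
  by rewrite LE; apply: le_trans (ub_le_sup ub (imageP _ Ez)).
have lip_le : (lip F setT <= L%:E)%E.
  apply: supremum_le; first by rewrite lee_fin.
  move=> _ [x [y [_ _ xy ->]]]; rewrite lee_fin ler_pdivrMr ?FL//.
  by rewrite normr_gt0 subr_eq0; exact/eqP.
have lip0 : (0 <= lip F setT)%E.
  by apply: supremum_ge0 => _ [x [y [_ _ xy ->]]]; rewrite lee_fin divr_ge0.
have lipE : lip F setT = (fine (lip F setT))%:E.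
  by rewrite fineK// ge0_fin_numE// (le_lt_trans lip_le) ?ltry.
have gradlip x : (`|grad dot F x|%:E <= lip F setT)%E.
  rewrite lipE lee_fin; apply: grad_norm_le; first by rewrite fine_ge0.
  move=> y y'; have [->|yy] := eqVneq y y'; first by rewrite !subrr !normr0 mulr0.
  rewrite -ler_pdivrMr ?normr_gt0 ?subr_eq0// -lee_fin -lipE.
  by apply: supremum_ge; exists y, y'; split=> //; exact/eqP.
have supL : (L%:E <= ereal_sup [set `|grad dot F x|%:E | x in setT])%E.
  rewrite LE -ereal_sup_EFin//; last by exists `|grad dot F z|; exists z.
  by apply: ereal_sup_le => _ [_ [y Ey <-] <-]; exists y.
have suplip : (ereal_sup [set `|grad dot F x|%:E | x in setT] <= lip F setT)%E.
  by apply: ge_ereal_sup => _ [x _ <-].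
have lipL : lip F setT = L%:E.
  by apply: le_anti; rewrite lip_le (le_trans supL).
by split=> //; apply: le_anti; rewrite suplip lipL supL.
Qed.

(** The tangent inequality at [x + h] in direction [- h] bounds the remainder by
    [dot (v (x + h) - v x) h], hence by [K * |h| * omega |h|], and [mul_modulus_le_phi] converts
    this to [phi] without integrating along the segment. *)
Lemma C1_omega_expansion (omega : R -> R) :
  modulus_of_continuity omega -> {in `[0, +oo[ &, {homo omega : s t / s < t}} ->
  (lip_omega omega (grad dot F) setT < +oo)%E ->
  exists2 A, 0 < A & forall x h,
    0 <= F (x + h) - F x - dot (grad dot F x) h <= A * phi omega `|h|.
Proof.
move=> om_mod om_incr lipoo; set v := grad dot F.
have om_gt0 t : 0 < t -> 0 < omega t.
  move=> t0; rewrite -[ltLHS](modulus0 om_mod).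
  by apply: om_incr; rewrite ?in_itv/= ?lexx ?ltW.
have lip0 : (0 <= lip_omega omega v setT)%E.
  apply: supremum_ge0 => _ [x [y [_ _ xy ->]]].
  by rewrite lee_fin divr_ge0// (modulus_ge0 om_mod).
have lipE : lip_omega omega v setT = (fine (lip_omega omega v setT))%:E.
  by rewrite fineK// ge0_fin_numE.
set K := fine _ in lipE; have K0 : 0 <= K by rewrite fine_ge0.
have vK x h : `|v (x + h) - v x| <= K * omega `|h|.
  have [->|h0] := eqVneq h 0.
    by rewrite addr0 subrr normr0 (modulus0 om_mod) mulr0.
  rewrite -ler_pdivrMr ?om_gt0 ?normr_gt0// -lee_fin -lipE.
  apply: supremum_ge; exists (x + h), x; split=> //; last first.
    by rewrite [x + h]addrC addrK.
  by apply/eqP; rewrite -subr_eq0 [x + h]addrC addrK.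
(* The [+ 1] keeps the constant positive when the gradient is constant and [K = 0]. *)
exists (2 * K + 1); first by rewrite ltr_wpDl// mulr_ge0.
move=> x h; apply/andP; split.
  by have := convex_above_tangent x h; rewrite -/v; lra.
have h1 := convex_above_tangent (x + h) (- h).
rewrite addrK dotNr -/v in h1.
have h2 : dot (v (x + h) - v x) h <= K * omega `|h| * `|h|.
  by rewrite (le_trans (dot_le_norm hilbert _ _))// ler_wpM2r.
have h3 : K * (`|h| * omega `|h|) <= K * (2 * phi omega `|h|).
  by rewrite ler_wpM2l// (mul_modulus_le_phi om_mod).
have h4 := phi_ge0 om_mod (normr_ge0 h).
rewrite dotBl in h2; move: (F x) (F (x + h)) h1 h2 h3 h4.
move: (dot (v x) h) (dot (v (x + h)) h) (phi omega _) => p q u F0 F1 h1 h2 h3 h4.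
by lra.
Qed.

End smooth_convex.

(** * Assembly of the equivalence and of the two explicit extensions *)

Theorem theorem1p3 (R : realType) (X : completeNormedModType R)
    (dot : {dot X for idfun}) (hilbert : norm_from dot)
    (omega : R -> R) (omega_modulus : modulus_of_continuity omega)
    (omega_incr : {in `[0, +oo[ &, {homo omega : s t / s < t}})
    (omega_oo : omega t @[t --> +oo] --> +oo)
    (E : set X) (E_neq0 : E !=set0) (f : X -> R) (G : X -> X) :
  [/\ (exists F : X -> R,
         [/\ convex_function setT F, C1_omega dot omega F
           & extends_jet dot E f G F])
      <-> (exists M : R, 0 < M /\ cond_star dot omega E f G M),
      forall M : R, 0 < M -> cond_star dot omega E f G M ->
        let g := upper_env dot omega E f G M in
        let F := conv_env g in
        ((forall x, has_inf (upper_values dot omega E f G M x))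
         /\ has_continuous_affine_minorant g) /\
        [/\ convex_function setT F, C1_omega dot omega F,
            extends_jet dot E f G F,
            (A_co dot omega F (grad dot F) setT <= (2 * M)%:E)%E
          & (lip_omega omega (grad dot F) setT <= (8 / 3 * M)%:E)%E]
    & forall M : R, 0 < M -> cond_star dot omega E f G M ->
        [bounded G z | z in E] ->
        let L := sup [set `|G z| | z in E] in
        let g := upper_env dot omega E f G M in
        let FL := conv_env_lip L g in
        ((forall x, has_inf (upper_values dot omega E f G M x))
         /\ has_lipschitz_affine_minorant L g) /\
        [/\ convex_function setT FL, C1_omega dot omega FL,
            extends_jet dot E f G FL,
            (A_co dot omega FL (grad dot FL) setT <= (2 * M)%:E)%E
          & (lip_omega omega (grad dot FL) setT <= (8 / 3 * M)%:E)%E] /\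
        [/\ (lip FL setT < +oo)%E,
            ereal_sup [set `|grad dot FL x|%:E | x in setT] = lip FL setT
          & lip FL setT = L%:E]].
Proof.
split.
- split=> [[F [cF [dF _ lipF] FE]]|[M [M0 star]]].
    have [A A0 FA] := C1_omega_expansion hilbert cF dF omega_modulus omega_incr lipF.
    exists A; split=> // y z Ey Ez.
    have [<- <-] := FE y Ey; have [<- <-] := FE z Ez.
    exact: (star_of_expansion hilbert omega_modulus (ltW A0) FA).
  have [cF C1F FE _ _] :=
    conv_env_extension hilbert omega_modulus omega_oo E_neq0 M0 star.
  by exists (conv_env (upper_env dot omega E f G M)).
- move=> M M0 star; split; last exact: conv_env_extension.
  split; first exact: has_inf_upper_values.
  exact: env_continuous_affine_minorant.
- move=> M M0 star Gb L.
  have ubG : has_ubound [set `|G z| | z in E].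
    (* Boundedness gives a bound for each real strictly above [B], hence [B + 1]. *)
    have [B [_ GB]] := Gb; exists (B + 1) => _ [z Ez <-].
    by apply: GB => //; rewrite ltrDl.
  have GL z : E z -> `|G z| <= L by move=> Ez; apply: ub_le_sup => //; exists z.
  have ext := conv_env_lip_extension hilbert omega_modulus omega_oo E_neq0 M0 star GL.
  split; first split.
  + exact: has_inf_upper_values.
  + exact: env_lipschitz_affine_minorant.
  + split=> //; have [cF [dF _ _] FE _ _] := ext.
    have lipF x y := conv_env_lip_lipschitz hilbert omega_modulus omega_oo E_neq0
      M0 star x y GL.
    have gE : [set `|grad dot (conv_env_lip L (upper_env dot omega E f G M)) z|
        | z in E] = [set `|G z| | z in E].
      by apply: eq_imagel => z Ez; have [_ ->] := FE z Ez.
    have [||e1 e2] := lip_grad hilbert cF dF E_neq0 lipF.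
    * by rewrite gE.
    * by rewrite gE.
    * by split=> //; rewrite e2 ltry.
Qed.
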